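(* Let $\mathbf L$ be a distributive bisemilattice. Let $X=\mathcal F(L)$ and $Y=\mathcal I(L)$, both partially ordered by inclusion. Topologize them by the subbases $\mathcal S=\{X_a\}_{a\in L}\cup\{\overline X_a\}_{a\in L}$ and $\mathcal P=\{Y_a\}_{a\in L}\cup\{\overline Y_a\}_{a\in L}$, where: - $X_a=\{F\in X:a\in F\}$ and $\overline X_a=\{F\in X:a\notin F\}$; - $Y_a=\{I\in Y:a\in I\}$ and $\overline Y_a=\{I\in Y:a\notin I\}$. Define $\rho(X_a)=\overline Y_a$. Then $\langle X,\rho,Y\rangle$ is a 2space.
   Context: **Bisemilattices.** A distributive bisemilattice is an algebra $\langle A,\land,\lor\rangle$ with both operations idempotent, commutative and associative, each distributing over the other. Write $a\le_\land b$ iff $a\land b=a$, and $a\le_\lor b$ iff $a\lor b=b$. A filter is a nonempty subset that is upward closed for $\le_\land$ and closed under $\land$. An ideal is a nonempty subset that is downward closed for $\le_\lor$ and closed under $\lor$. $\mathcal F(L)$ and $\mathcal I(L)$ denote the sets of filters and ideals. **Fspaces.** An Fspace is a Stone space $X$ (compact, Hausdorff, zero-dimensional) with a partial order $\le$ such that: (1) every subset has a greatest lower bound; (2) there is a clopen subbasis $\{X_i\}_{i\in I}\cup\{\overline X_i\}_{i\in I}$, where each $X_i=\{x:x_i\le x\}$ is the principal upper set of a point $x_i$ and $\overline X_i=X\setminus X_i$; (3) every $x$ is the least upper bound of $\{x_i:x_i\le x\}$; (4) $X^*=\{X_i\}$ is closed under finite intersections. Put $\overline X^*=\{\overline X_i\}$.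 **2spaces.** A 2space is a triple $\langle X,\rho,Y\rangle$ consisting of: - Fspaces $X,Y$ with subbases $\{X_a\}_{a\in A}\cup\{\overline X_a\}_{a\in A}$ and $\{Y_a\}_{a\in A}\cup\{\overline Y_a\}_{a\in A}$ indexed by a common set $A$; - a bijection $\rho:X^*\to\overline Y^*$ with $\rho(X_a)=\overline Y_a$, satisfying for all $P,Q,R\in X^*$: $P\cap\rho^{-1}(\rho(Q)\cup\rho(R))=\rho^{-1}(\rho(P\cap Q)\cup\rho(P\cap R))$, and for all $P,Q,R\in\overline Y^*$: $P\cup\rho(\rho^{-1}(Q)\cap\rho^{-1}(R))=\rho(\rho^{-1}(P\cup Q)\cap\rho^{-1}(P\cup R))$.
   Formalization: As stated the claim fails when L lacks a ≤_∧-greatest or a ≤_∨-least element (no least filter or ideal); here the empty set is adjoined to X exactly when L has no ≤_∧-greatest element, and to Y exactly when L has no ≤_∨-least element. *)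

(* Defs.v *)
From HB Require Import structures.
From mathcomp Require Import all_boot all_order.
From mathcomp Require Import finmap all_classical.
From mathcomp Require Import topology.

Set Implicit Arguments.
Unset Strict Implicit.
Unset Printing Implicit Defensive.

Import Order.TTheory.
Local Open Scope classical_set_scope.

(** Distributive bisemilattices, filters and ideals *)

Record distributive_bisemilattice (L : Type) (meet join : L -> L -> L) : Prop :=
  DistributiveBisemilattice {
    dbs_meetI : idempotent_op meet;
    dbs_meetC : commutative meet;
    dbs_meetA : associative meet;
    dbs_joinI : idempotent_op join;
    dbs_joinC : commutative join;
    dbs_joinA : associative join;
    dbs_meet_joinl : left_distributive meet join;
    dbs_meet_joinr : right_distributive meet join;
    dbs_join_meetl : left_distributive join meet;
    dbs_join_meetr : right_distributive join meet }.

(* There is no absorption law, so these two orders are unrelated in general. *)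
Definition meet_le (L : Type) (meet : L -> L -> L) (a b : L) : Prop :=
  meet a b = a.
Definition join_le (L : Type) (join : L -> L -> L) (a b : L) : Prop :=
  join a b = b.

Definition filters (L : Type) (meet : L -> L -> L) : set (set L) :=
  [set F | [/\ F !=set0,
    forall a b, F a -> meet_le meet a b -> F b &
    forall a b, F a -> F b -> F (meet a b)]].

Definition ideals (L : Type) (join : L -> L -> L) : set (set L) :=
  [set J | [/\ J !=set0,
    forall a b, J b -> join_le join a b -> J a &
    forall a b, J a -> J b -> J (join a b)]].

(* The literal sets of nonempty filters and ideals violate axiom (1) of Fspaces
   unless [meet_le] has a greatest and [join_le] a least element: see
   [filters_inf_top] and [ideals_inf_bottom] below.  In exactly those cases the
   empty set is adjoined as the missing least point. *)
Definition filter_points (L : Type) (meet : L -> L -> L) : set (set L) :=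
  filters meet `|`
  [set F | F = set0 /\ ~ exists e, forall a, meet_le meet a e].

Definition ideal_points (L : Type) (join : L -> L -> L) : set (set L) :=
  ideals join `|`
  [set J | J = set0 /\ ~ exists e, forall a, join_le join e a].

Lemma filter_pointsE (L : Type) (meet : L -> L -> L) (e : L) :
  (forall a, meet_le meet a e) -> filter_points meet = filters meet.
Proof.
move=> le_e; apply/seteqP; split=> [F [//|[_ []]]|F]; last by left.
by exists e.
Qed.

Lemma ideal_pointsE (L : Type) (join : L -> L -> L) (e : L) :
  (forall a, join_le join e a) -> ideal_points join = ideals join.
Proof.
move=> ge_e; apply/seteqP; split=> [J [//|[_ []]]|J]; last by left.
by exists e.
Qed.

(** Spaces whose points are the members of a family [P] of subsets of [L],
    ordered by inclusion *)

Definition set_space (L : Type) (P : set (set L)) : Type := set_type P.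

Section set_space.
Context {L : Type} {P : set (set L)}.
Local Notation T := (set_space P).

HB.instance Definition _ := SubChoice.on T.
HB.instance Definition _ := [SubChoice_isSubPOrder of T by <: with set_display].

Definition contains (a : L) : set T := [set F | val F a].

HB.instance Definition _ :=
  isSubBaseTopological.Build T (range contains `|` range (setC \o contains)) id.

End set_space.

(* Necessity of the empty point. *)
Lemma filters_inf_top (L : Type) (meet join : L -> L -> L) :
  distributive_bisemilattice meet join ->
  infimums [set: set_space (filters meet)] !=set0 ->
  exists e, forall a, meet_le meet a e.
Proof.
move=> [mI _ mA _ _ _ _ _ _ _] [F [lbF _]].
have [[e Fe] _ _] := set_mem (valP F).
exists e => a; have up : filters meet (meet_le meet a).
  split=> [|b c /=|b c]; rewrite /meet_le; first by exists a; exact: mI.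
    by move=> <- bc; rewrite -mA bc.
  by rewrite mA => ->.
pose G : set_space (filters meet) :=
  exist (fun A => A \in filters meet) _ (mem_set up).
by have /asboolP/(_ e Fe) : (F <= G)%O by exact: lbF.
Qed.

Lemma ideals_inf_bottom (L : Type) (meet join : L -> L -> L) :
  distributive_bisemilattice meet join ->
  infimums [set: set_space (ideals join)] !=set0 ->
  exists e, forall a, join_le join e a.
Proof.
move=> [_ _ _ jI _ jA _ _ _ _] [F [lbF _]].
have [[e Fe] _ _] := set_mem (valP F).
exists e => a; have dn : ideals join ((join_le join)^~ a).
  split=> [|b c /=|b c]; rewrite /join_le; first by exists a; exact: jI.
    by move=> ca bc; rewrite -ca jA bc.
  by rewrite -jA => + ->.
pose G : set_space (ideals join) :=
  exist (fun A => A \in ideals join) _ (mem_set dn).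
by have /asboolP/(_ e Fe) : (F <= G)%O by exact: lbF.
Qed.

(** Fspaces and 2spaces *)

(* The library's [zero_dimensional] is the separation of points by clopen sets,
   which agrees with the existence of a clopen base only in the compact case. *)
Definition stone_space (X : topologicalType) : Prop :=
  [/\ compact [set: X], hausdorff_space X & basis (@clopen X)].

Definition subbasis (X : topologicalType) (S : set (set X)) : Prop :=
  S `<=` open /\ basis (finI_from S id).

(* [X] is an Fspace with respect to the indexed family [U] of sets [X_i]. *)
Record fspace (d : Order.disp_t) (X : POrderedTopological.type d) (I : Type)
    (U : I -> set X) : Prop := FSpace {
  fspace_stone : stone_space X;
  fspace_inf : forall S : set X, infimums S !=set0;
  fspace_subbasis : subbasis (range U `|` range (setC \o U));
  fspace_clopen : range U `|` range (setC \o U) `<=` clopen;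
  fspace_principal : exists p : I -> X,
    (forall i, U i = [set x | (p i <= x)%O]) /\
    (forall x, supremums [set p i | i in [set i | (p i <= x)%O]] x);
  fspace_setI : setI_closed (range U) }.

(* [rho] is only relevant on X^* = [range U]; [pinv (range U) rho] is its
   inverse there. *)
Record two_space (dX dY : Order.disp_t) (X : POrderedTopological.type dX)
    (Y : POrderedTopological.type dY) (A : Type) (U : A -> set X)
    (V : A -> set Y) (rho : set X -> set Y) : Prop := TwoSpace {
  two_space_X : fspace U;
  two_space_Y : fspace V;
  two_space_bij : set_bij (range U) (range (setC \o V)) rho;
  two_spaceE : forall a, rho (U a) = ~` V a;
  two_space_distrI : let rhoV := pinv (range U) rho in
    forall P Q R, range U P -> range U Q -> range U R ->
    P `&` rhoV (rho Q `|` rho R) = rhoV (rho (P `&` Q) `|` rho (P `&` R));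
  two_space_distrU : let rhoV := pinv (range U) rho in
    forall P Q R, range (setC \o V) P -> range (setC \o V) Q ->
      range (setC \o V) R ->
    P `|` rho (rhoV Q `&` rhoV R) = rho (rhoV (P `|` Q) `&` rhoV (P `|` R)) }.

(* Main.v *)
(** The points are exactly the sets [F] with [meet a b \in F] iff [a, b \in F]
    that contain every greatest element of [meet_le].  These conditions pass to
    intersections, which gives infima, and to ultrafilter limits
    [{a | contains a \in U}], which gives compactness.  By commutativity the
    ideals of [join] are the filters of [join], so both halves are the same
    statement about a semilattice.  Since [X_a] meets [X_b] in [X_(meet a b)],
    and dually for [Y], the two identities on [rho] are the two distributive
    laws read on indices. *)

Require Import Defs.
From HB Require Import structures.
From mathcomp Require Import all_boot all_order.
From mathcomp Require Import all_classical.
From mathcomp Require Import topology.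

Set Implicit Arguments.
Unset Strict Implicit.

Local Open Scope classical_set_scope.

Section set_space_topology.
Context {L : Type} {P : set (set L)}.
Local Notation T := (set_space P).
Local Notation S := (range (@contains L P) `|` range (setC \o @contains L P)).

Lemma set_space_basis : basis (finI_from S id).
Proof.
split=> [A SA|x A /= [B [[D DS <-] [C DC Cx] sBA]]].
  exists [set A]; first by move=> _ ->.
  by rewrite bigcup_set1.
exists C; first by split => //; exact: DS.
by move=> y Cy; apply: sBA; exists C.
Qed.

Lemma set_space_subbasis : subbasis S.
Proof.
split; last exact: set_space_basis.
move=> A SA; apply: (proj1 set_space_basis).
exact: (@finI_from1 _ _ _ id).
Qed.

Lemma set_space_clopen : S `<=` clopen.
Proof.
have oS := proj1 set_space_subbasis.
have oa a : open (contains a : set T) by apply: oS; left; exists a.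
have oNa a : open (~` contains a : set T) by apply: oS; right; exists a.
move=> _ [[a _ <-]|[a _ <-]]; split=> //=; last exact: open_closedC.
by rewrite -[contains a]setCK; exact: open_closedC.
Qed.

Lemma set_space_clopen_basis : basis (@clopen T).
Proof.
(* Finite intersections of subbasic sets already form a base, and they are clopen. *)
split=> [A []//|x]; apply: cvg_trans (proj2 set_space_basis x).
move=> A [B [SB Bx] sBA]; exists B => //; split => //; split.
  exact: (proj1 set_space_basis).
have [D DS <-] := SB.
by apply: closed_bigI => C /DS /set_mem/set_space_clopen [].
Qed.

Lemma set_space_hausdorff : hausdorff_space T.
Proof.
rewrite open_hausdorff => x y xy.
have cl a := set_space_clopen (or_introl (imageT (@contains L P) a)).
have [a] : exists a, ~ (val x a <-> val y a).
  apply/existsNP => exy; case/eqP: xy; apply/val_inj/funext => a.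
  exact/propext.
have [xa xya|nxa xya] := pselect (val x a).
  exists (contains a, ~` contains a) => /=; last first.
    split; [exact: (cl a).1|exact/closed_openC/(cl a).2|].
    by rewrite setICr.
  by split; apply/mem_set => // ya; apply: xya.
exists (~` contains a, contains a) => /=; last first.
  split; [exact/closed_openC/(cl a).2|exact: (cl a).1|].
  by rewrite setICl.
split; apply/mem_set => //.
by apply: contrapT => nya; apply: xya; split => // ya.
Qed.

(** It suffices to test subbasic neighbourhoods of [x]; for a complement, maximality of [F] turns
    absence of [contains a] into presence of its complement. *)
Lemma set_space_ultra_cvg {F : set_system T} (x : T) : UltraFilter F ->
  (forall a, val x a <-> F (contains a)) -> F --> x.
Proof.
move=> FU xF; apply: cvg_trans (proj2 set_space_basis x).
move=> A [B [[D DS <-] Dx] sBA]; apply: filterS sBA _.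
apply: filter_bigI => C DC; have Cx := Dx C DC.
case/DS/set_mem: DC Cx => -[a _ <-] /= Cx; first exact/xF.
by have [/xF|//] := in_ultra_setVsetC (contains a) FU.
Qed.

Lemma set_space_leP (x y : T) :
  (x <= y)%O <-> (forall a, val x a -> val y a).
Proof. by split=> [/asboolP|xy]; last exact/asboolP. Qed.

End set_space_topology.

Section filter_points.
Context {L : Type} {meet : L -> L -> L}.
Hypotheses (meetI : idempotent_op meet) (meetC : commutative meet)
  (meetA : associative meet).

(** The empty set meets the first condition trivially, and the second exactly when no greatest
    element exists, which is when it is adjoined. *)
Lemma filter_pointsP F : filter_points meet F <->
  (forall a b, F (meet a b) <-> F a /\ F b) /\
  (forall e, (forall a, meet_le meet a e) -> F e).
Proof.
split=> [[[[c Fc] up mF]|[-> ntop]]|[mF topF]].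
- split=> [a b|e le_e]; last by apply: up Fc _.
  split=> [Fab|[Fa Fb]]; last exact: mF.
  split; apply: up Fab _; rewrite /meet_le; last by rewrite -meetA meetI.
  by rewrite meetC meetA meetI.
- by split=> [a b|e le_e]; [split=> -[]|apply: ntop; exists e].
have [F0|/set0P F0] := eqVneq F set0.
  right; split=> // -[e /topF]; rewrite F0; exact.
left; split=> // [a b Fa ab|a b Fa Fb]; last exact/mF.
by move: Fa; rewrite -ab => /mF[].
Qed.

Lemma filter_points_up a : filter_points meet (meet_le meet a).
Proof.
apply/filter_pointsP; split=> [b c|e le_e]; last exact: le_e.
rewrite /meet_le; split=> [abc|[ab ac]]; last by rewrite meetA ab ac.
split; rewrite -abc; last by rewrite -!meetA meetI.
by rewrite -!meetA [meet c b]meetC (meetA b) meetI.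
Qed.

Section point_space.
Context {P : set (set L)}.
(* An equation rather than an instance, so that the results also apply to the
   type [set_space (ideal_points join)]. *)
Hypothesis PE : P = filter_points meet.
Local Notation T := (set_space P).

Let mem_points F : filter_points meet F -> F \in P.
Proof. by rewrite PE => /mem_set. Qed.

Let point (F : set L) (PF : filter_points meet F) : T :=
  exist (fun A => A \in P) F (mem_points PF).

Let mem_meet (x : T) a b : val x (meet a b) <-> val x a /\ val x b.
Proof.
(* Only the head [P] is rewritten, since [P] also occurs in the type of [x]. *)
by have := set_mem (valP x); rewrite {1}PE => /filter_pointsP[].
Qed.

Let mem_top (x : T) e : (forall a, meet_le meet a e) -> val x e.
Proof.
by have := set_mem (valP x); rewrite {1}PE => /filter_pointsP[_]; apply.
Qed.

Lemma filter_points_compact : compact [set: T].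
Proof.
rewrite compact_ultra => F FU _.
have FG : filter_points meet [set a | F (contains a)].
  apply/filter_pointsP; split=> [a b|e le_e] /=; last first.
    by apply: filterS filterT => x _; exact: mem_top.
  split=> [Fab|[Fa Fb]].
    by split; apply: filterS Fab => x /mem_meet[].
  by apply: filterS (filterI Fa Fb) => x [xa xb]; apply/mem_meet.
by exists (point FG); split=> //; apply: set_space_ultra_cvg => a.
Qed.

Lemma filter_points_infimums (S : set T) : infimums S !=set0.
Proof.
(* The intersection of the members of [S]; for empty [S] it is all of [L]. *)
have SG : filter_points meet [set a | forall x : T, S x -> val x a].
  apply/filter_pointsP; split=> [a b|e le_e x Sx] /=; last exact: mem_top.
  split=> [Sab|[Sa Sb] x Sx]; last by apply/mem_meet; split;
    [exact: Sa|exact: Sb].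
  by split=> x /Sab/mem_meet[].
exists (point SG); split=> [x Sx|y lby]; apply/set_space_leP => a.
  exact.
by move=> ya x /lby/set_space_leP; exact.
Qed.

Let up a : T := point (filter_points_up a).

(** The principal filter of [a] is the least point containing [a], so it serves as the point [x_a]
    of the Fspace axioms. *)
Let up_le (x : T) a : (up a <= x)%O <-> val x a.
Proof.
split=> [/set_space_leP|xa]; first by apply; exact: meetI.
by apply/set_space_leP => b; rewrite /= /meet_le => ab; move: xa;
  rewrite -ab => /mem_meet[].
Qed.

Lemma containsI a b :
  contains a `&` contains b = contains (meet a b) :> set T.
Proof. by apply/seteqP; split=> x /mem_meet. Qed.

(** Testing the equality on principal filters gives both [meet_le] inequalities. This is what lets
    [rho] be defined on sets rather than on indices. *)
Lemma contains_inj : injective (@contains L P).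
Proof.
move=> a b ab.
have le c d : contains c = contains d :> set T -> meet d c = d.
  move=> cd; have : contains c (up c) by exact: meetI.
  have : contains d (up d) by exact: meetI.
  by rewrite -cd.
by rewrite -(le b a) // meetC le.
Qed.

Lemma filter_points_fspace : fspace (@contains L P).
Proof.
split.
- split; [exact: filter_points_compact|exact: set_space_hausdorff|].
  exact: set_space_clopen_basis.
- exact: filter_points_infimums.
- exact: set_space_subbasis.
- exact: set_space_clopen.
- exists up; split=> [a|x]; first by apply/seteqP; split=> x /up_le.
  (* A point is the union of the principal filters of its elements. *)
  split=> [_ [a ax <-] //|y uby]; apply/set_space_leP => a /up_le ax.
  by apply/up_le/uby; exists a.
- by move=> _ _ [a _ <-] [b _ <-]; rewrite containsI; exists (meet a b).
Qed.

End point_space.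
End filter_points.

(** Commutativity makes [join_le] the reverse of [meet_le join]: downward closure becomes upward
    closure, and a least element becomes a greatest one. *)
Lemma ideal_points_filter_points (L : Type) (join : L -> L -> L) :
  commutative join -> ideal_points join = filter_points join.
Proof.
move=> joinC; rewrite /ideal_points /filter_points.
have leE a b : join_le join a b = meet_le join b a.
  by rewrite /join_le /meet_le joinC.
congr (_ `|` _); apply/seteqP; split=> F.
- by case=> F0 dn jF; split=> // a b Fa ab; apply: dn Fa _; rewrite leE.
- by case=> F0 up jF; split=> // a b Fb; rewrite leE; exact: up.
- by case=> -> nbot; split=> // -[e le_e]; apply: nbot; exists e => a;
    rewrite leE.
- by case=> -> ntop; split=> // -[e le_e]; apply: ntop; exists e => a;
    rewrite -leE.
Qed.

Theorem theorem6p3 (L : Type) (meet join : L -> L -> L)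
    (hL : distributive_bisemilattice meet join) :
  let X := set_space (filter_points meet) in
  let Y := set_space (ideal_points join) in
  let Xa := (fun a => [set F : X | val F a]) in
  let Ya := (fun a => [set J : Y | val J a]) in
  exists2 rho : set X -> set Y, (forall a, rho (Xa a) = ~` Ya a) &
    two_space Xa Ya rho.
Proof.
case: hL => mI mC mA jI jC jA _ mjr _ jmr X Y Xa Ya.
have YE := ideal_points_filter_points jC.
have Xinj : injective Xa := contains_inj mI mC mA erefl.
have Yinj : injective Ya := contains_inj jI jC jA YE.
have XI a b : Xa a `&` Xa b = Xa (meet a b) := containsI mI mC mA erefl a b.
have YI a b : Ya a `&` Ya b = Ya (join a b) := containsI jI jC jA YE a b.
(* Off the range of [Xa] the value is empty; on it, injectivity of [Xa] makes the index unique. *)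
pose rho (A : set X) : set Y := [set y | exists2 a, A = Xa a & ~ Ya a y].
have rhoE a : rho (Xa a) = ~` Ya a.
  by apply/seteqP; split=> [y [b /Xinj <-]//|y ?]; exists a.
have rho_inj : {in range Xa &, injective rho}.
  move=> _ _ /set_mem[a _ <-] /set_mem[b _ <-].
  by rewrite !rhoE => /(congr1 setC); rewrite !setCK => /Yinj ->.
exists rho => //.
have rhoVE a : pinv (range Xa) rho (~` Ya a) = Xa a.
  by rewrite -rhoE (pinvKV _ rho_inj) //; apply/mem_set; exists a.
have YU a b : ~` Ya a `|` ~` Ya b = ~` Ya (join a b) by rewrite -setCI YI.
split.
- exact: (filter_points_fspace mI mC mA erefl).
- exact: (filter_points_fspace jI jC jA YE).
- split=> //; first by move=> _ [a _ <-]; rewrite rhoE; exists a.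
  by move=> _ [a _ <-]; exists (Xa a); [exists a|rewrite rhoE].
- exact: rhoE.
- move=> rhoV _ _ _ [a _ <-] [b _ <-] [c _ <-].
  by rewrite /rhoV !XI !rhoE !YU !rhoVE XI mjr.
- move=> rhoV _ _ _ [a _ <-] [b _ <-] [c _ <-] /=.
  by rewrite /rhoV !YU !rhoVE !XI !rhoE YU jmr.
Qed.
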